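(* Let $Q\in\mathrm{SO}_n$ and $S\in\mathrm{Skew}_n$. If $X$ is a D-preimage of $Q$ satisfying $\|X-S\|_2<\pi$, then $X$ is the unique solution of $$\underset{Z\in\exp^{-1}(Q)}{\arg\min}\ \|Z-S\|_F .$$
   Context: $\mathrm{Skew}_n$: real $n\times n$ skew-symmetric matrices; $\mathrm{SO}_n$: special orthogonal group; $\exp^{-1}(Q)=\{Z\in\mathrm{Skew}_n:\exp(Z)=Q\}$. $\mathfrak S$ is the set of $Z\in\mathrm{Skew}_n$ at which the differential of $\exp:\mathrm{Skew}_n\to\mathrm{SO}_n$ is rank-deficient. A D-preimage of $Q$ is an element of $\exp^{-1}(Q)\cap(\mathrm{Skew}_n\setminus\mathfrak S)$. $\|\cdot\|_2$ is the spectral norm and $\|\cdot\|_F$ the Frobenius norm. *)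

(* Defs.v *)
From HB Require Import structures.
From mathcomp Require Import all_boot all_order all_algebra.
From mathcomp Require Import all_classical all_reals all_analysis.

Set Implicit Arguments.
Unset Strict Implicit.
Unset Printing Implicit Defensive.

Import Order.TTheory GRing.Theory Num.Theory.
Import numFieldNormedType.Exports.

Local Open Scope classical_set_scope.
Local Open Scope ring_scope.

Definition Skew (R : realType) (n : nat) : set 'M[R]_n :=
  [set A | A^T = - A].

Definition SO (R : realType) (n : nat) : set 'M[R]_n :=
  [set Q | Q^T *m Q = 1%:M /\ \det Q = 1].

Definition expm (R : realType) (n : nat) (A : 'M[R]_n) : 'M[R]_n :=
  limn (series (fun k : nat => (k`!%:R)^-1 *: A ^+ k)).

(* exp^-1(Q): the preimages are taken among skew-symmetric matrices only. *)
Definition skew_log (R : realType) (n : nat) (Q : 'M[R]_n) : set 'M[R]_n :=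
  [set Z | Skew Z /\ expm Z = Q].

Definition add_trmx (R : realType) (n : nat) (A : 'M[R]_n) : 'M[R]_n :=
  A + A^T.

Fact add_trmx_is_linear (R : realType) (n : nat) : linear (@add_trmx R n).
Proof.
by move=> a A B; rewrite /add_trmx linearP scalerDr addrACA.
Qed.

HB.instance Definition _ (R : realType) (n : nat) :=
  GRing.isLinear.Build R 'M[R]_n 'M[R]_n *:%R (@add_trmx R n)
    (@add_trmx_is_linear R n).

(* The set Skew as a vector subspace, see [mem_skewv]. *)
Definition skewv (R : realType) (n : nat) : {vspace 'M[R]_n} :=
  lker (linfun (@add_trmx R n)).

Lemma mem_skewv (R : realType) (n : nat) (A : 'M[R]_n) :
  A \in skewv R n <-> Skew A.
Proof.
rewrite memv_ker lfunE /= /add_trmx addrC addr_eq0.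
by split=> [/eqP|AN]; [|apply/eqP].
Qed.

(* The differential at Z of exp : Skew_n -> SO_n is the restriction to the
   tangent space Skew_n of the differential of exp on all matrices.  Since
   Skew_n and SO_n have the same dimension, full rank means rank \dim Skew_n. *)
Definition dexp_rank_deficient (R : realType) (n : nat) : set 'M[R]_n :=
  [set Z | Skew Z /\
    (\dim (linfun ('d (@expm R n) Z) @: skewv R n)%VS < \dim (skewv R n))%N].

Definition D_preimage (R : realType) (n : nat) (Q : 'M[R]_n) : set 'M[R]_n :=
  skew_log Q `&` (@Skew R n `\` @dexp_rank_deficient R n).

Definition frobenius_norm (R : realType) (m n : nat) (A : 'M[R]_(m, n)) : R :=
  Num.sqrt (\sum_i \sum_j A i j ^+ 2).

(* The operator norm induced by the Euclidean norm, the latter being the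
   Frobenius norm of column vectors. *)
Definition spectral_norm (R : realType) (m n : nat) (A : 'M[R]_(m, n)) : R :=
  sup [set frobenius_norm (A *m x) |
         x in [set x : 'cV[R]_n | frobenius_norm x <= 1]].

Definition argmin (R : realType) (T : Type) (D : set T) (f : T -> R) : set T :=
  [set z | D z /\ forall w, D w -> f z <= f w].

(* Main.v *)
(** Let Z be another preimage of Q.

    Commutation: Z commutes with Q = exp X, hence so does 1 + t Z, so that
    (1 + t Z)^-1 X (1 + t Z) = X + t (1 + t Z)^-1 [X, Z] is a curve on which exp
    takes the constant value Q.  Its tangent vector [X, Z] at t = 0 is killed by
    the differential of exp at X; it is skew-symmetric and X is a D-preimage, so
    [X, Z] = 0.

    Distance: X and Z are therefore diagonal in a common unitary basis a_j + i b_j,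
    with eigenvalues i x_j and i z_j such that exp (i x_j) = exp (i z_j).  Hence
    d_j = z_j - x_j is 0 or at least 2 pi in absolute value.  With W = X - S,
    |Z - S|_F^2 - |X - S|_F^2 = sum_j (d_j^2 + 2 d_j w_j), where
    w_j = b_j W a_j^T - a_j W b_j^T satisfies |w_j| <= |W|_2 < pi, and every
    summand with d_j <> 0 is positive. *)

From HB Require Import structures.
Require Import Defs.
From mathcomp Require Import all_boot all_order all_algebra.
From mathcomp Require Import all_classical all_reals all_analysis.
From mathcomp Require Import complex ring lra.

Set Implicit Arguments.
Unset Strict Implicit.
Unset Printing Implicit Defensive.

Import Order.TTheory GRing.Theory Num.Theory.
Import numFieldNormedType.Exports.

Local Open Scope classical_set_scope.
Local Open Scope ring_scope.

(** * Frobenius and spectral norms *)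

Lemma frobenius_norm_ge0 (R : realType) m n (A : 'M[R]_(m, n)) :
  0 <= frobenius_norm A.
Proof. exact: sqrtr_ge0. Qed.

Lemma frobenius_norm_sqr (R : realType) m n (A : 'M[R]_(m, n)) :
  frobenius_norm A ^+ 2 = \tr (A *m A^T).
Proof.
rewrite sqr_sqrtr; last by do 2![apply: sumr_ge0 => ? _]; rewrite sqr_ge0.
by apply: eq_bigr => i _; rewrite mxE; apply: eq_bigr => j _; rewrite mxE expr2.
Qed.

Lemma frobenius_norm_tr (R : realType) m n (A : 'M[R]_(m, n)) :
  frobenius_norm A^T = frobenius_norm A.
Proof.
rewrite /frobenius_norm exchange_big /=; congr Num.sqrt.
by do 2![apply: eq_bigr => ? _]; rewrite mxE.
Qed.

Lemma frobenius_normZ (R : realType) m n (c : R) (A : 'M[R]_(m, n)) :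
  frobenius_norm (c *: A) = `|c| * frobenius_norm A.
Proof.
apply: (@pexpIrn _ 2); rewrite ?nnegrE ?mulr_ge0 ?frobenius_norm_ge0 //.
rewrite exprMn !frobenius_norm_sqr real_normK ?num_real // linearZ /=.
by rewrite -scalemxAl -scalemxAr !mxtraceZ; ring.
Qed.

Lemma frobenius_norm0_eq0 (R : realType) m n (A : 'M[R]_(m, n)) :
  frobenius_norm A = 0 -> A = 0.
Proof.
move=> A0; have := frobenius_norm_sqr A; rewrite A0 expr0n /= => /esym/eqP.
rewrite psumr_eq0; last first.
  by move=> i _; rewrite mxE; apply: sumr_ge0 => j _; rewrite mxE -expr2 sqr_ge0.
move=> /allP Ai0; apply/matrixP => i j; rewrite mxE.
have /implyP/(_ isT) := Ai0 i (mem_index_enum _).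
rewrite mxE psumr_eq0; last by move=> k _; rewrite mxE -expr2 sqr_ge0.
move=> /allP/(_ j (mem_index_enum _)).
by rewrite mxE -expr2 sqrf_eq0 => /eqP.
Qed.

(** Lagrange's identity: the double sum of the squares of [x i * y j - x j * y i] is twice the
    difference of the two sides. *)
Lemma sum_CauchySchwarz (R : realFieldType) (I : finType) (x y : I -> R) :
  (\sum_i x i * y i) ^+ 2 <= (\sum_i x i ^+ 2) * (\sum_i y i ^+ 2).
Proof.
have : 0 <= \sum_i \sum_j (x i * y j - x j * y i) ^+ 2.
  by do 2![apply: sumr_ge0 => ? _]; rewrite sqr_ge0.
rewrite (_ : \sum_i _ = \sum_i \sum_j x i ^+ 2 * y j ^+ 2 +
  \sum_i \sum_j x j ^+ 2 * y i ^+ 2 -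
  2 * \sum_i \sum_j (x i * y i) * (x j * y j)); last first.
  rewrite mulr_sumr -big_split -sumrB; apply: eq_bigr => i _ /=.
  rewrite mulr_sumr -big_split -sumrB; apply: eq_bigr => j _ /=; ring.
rewrite [X in _ + X - _]exchange_big -!big_distrlr /= => h.
by rewrite expr2; lra.
Qed.

Lemma frobenius_norm_mul (R : realType) m n p (A : 'M[R]_(m, n))
    (B : 'M[R]_(n, p)) :
  frobenius_norm (A *m B) <= frobenius_norm A * frobenius_norm B.
Proof.
rewrite -(@ler_pXn2r _ 2) ?nnegrE ?mulr_ge0 ?frobenius_norm_ge0 //.
rewrite -[frobenius_norm B]frobenius_norm_tr exprMn.
rewrite ![frobenius_norm _ ^+ 2]sqr_sqrtr; first last.
- by do 2![apply: sumr_ge0 => ? _]; rewrite sqr_ge0.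
- by do 2![apply: sumr_ge0 => ? _]; rewrite sqr_ge0.
- by do 2![apply: sumr_ge0 => ? _]; rewrite sqr_ge0.
rewrite big_distrlr /=; do 2![apply: ler_sum => ? _].
rewrite mxE (le_trans (sum_CauchySchwarz _ _)) //.
rewrite le_eqVlt; apply/orP; left; apply/eqP; congr (_ * _).
by apply: eq_bigr => k _; rewrite mxE.
Qed.

Lemma frobenius_norm0 (R : realType) m n :
  frobenius_norm (0 : 'M[R]_(m, n)) = 0.
Proof. by rewrite -(scale0r 0) frobenius_normZ normr0 mul0r. Qed.

Lemma frobenius_norm11 (R : realType) (A : 'M[R]_1) :
  frobenius_norm A = `|A 0 0|.
Proof. by rewrite /frobenius_norm !big_ord1 sqrtr_sqr. Qed.

(** The set under [sup] is bounded by the Frobenius norm of [A], so [sup] is a genuine least upper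
    bound and not its default value. *)
Lemma spectral_norm_ubound (R : realType) m n (A : 'M[R]_(m, n)) (x : 'cV[R]_n) :
  frobenius_norm x <= 1 -> frobenius_norm (A *m x) <= spectral_norm A.
Proof.
move=> x1; apply: sup_ubound; last by exists x.
exists (frobenius_norm A) => _ [y /= y1 <-].
rewrite (le_trans (frobenius_norm_mul _ _)) //.
by rewrite ler_piMr ?frobenius_norm_ge0.
Qed.

Lemma spectral_norm_ge0 (R : realType) m n (A : 'M[R]_(m, n)) :
  0 <= spectral_norm A.
Proof.
apply: le_trans (frobenius_norm_ge0 (A *m 0 : 'cV_m)) _.
by rewrite spectral_norm_ubound // frobenius_norm0.
Qed.

Lemma le_spectral_norm (R : realType) m n (A : 'M[R]_(m, n)) (x : 'cV[R]_n) :
  frobenius_norm (A *m x) <= spectral_norm A * frobenius_norm x.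
Proof.
have [x0|x_neq0] := eqVneq (frobenius_norm x) 0.
  by rewrite x0 mulr0 (frobenius_norm0_eq0 x0) mulmx0 frobenius_norm0.
have x_gt0 : 0 < frobenius_norm x by rewrite lt0r x_neq0 frobenius_norm_ge0.
rewrite -ler_pdivrMr // mulrC.
rewrite -[X in X * _]ger0_norm ?invr_ge0 ?frobenius_norm_ge0 //.
rewrite -frobenius_normZ scalemxAr spectral_norm_ubound // frobenius_normZ.
by rewrite ger0_norm ?invr_ge0 ?frobenius_norm_ge0 // mulVf.
Qed.

(** * Matrices as a complete normed space, under the maximum norm *)

HB.instance Definition _ (R : realType) m n := Complete.on (matrix R m n).

Section mx_norm_theory.
Variable R : realType.

Lemma mx_norm_entry m n (A : 'M[R]_(m, n)) i j : `|A i j| <= `|A|.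
Proof.
by rewrite [leRHS]/Num.norm /= mx_normrE; apply/bigmax_geP; right; exists (i, j).
Qed.

(** The norm here is the largest absolute value of an entry; the factor [n] counts the terms in each
    entry of the product. *)
Lemma mx_norm_mul m n p (A : 'M[R]_(m, n)) (B : 'M[R]_(n, p)) :
  `|A *m B| <= n%:R * `|A| * `|B|.
Proof.
rewrite [leLHS]/Num.norm /= mx_normrE; apply/bigmax_leP; split => [|[i j] _] /=.
  by rewrite !mulr_ge0.
rewrite mxE (le_trans (ler_norm_sum _ _ _)) //.
rewrite -mulrA mulr_natl -[X in _ *+ X]card_ord -sumr_const ler_sum // => k _.
by rewrite normrM ler_pM // mx_norm_entry.
Qed.

Lemma continuous_mulmx m n p (A : 'M[R]_(m, n)) :
  continuous (mulmx A : 'M[R]_(n, p) -> 'M[R]_(m, p)).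
Proof.
apply/(linear_bounded_continuous (mulmx A)).
apply/linear_boundedP; near=> r => B.
rewrite (le_trans (mx_norm_mul _ _)) //.
by apply: ler_wpM2r => //; near: r; exact: nbhs_pinfty_ge.
Unshelve. all: by end_near. Qed.

Lemma continuous_mulmxr m n p (A : 'M[R]_(n, p)) :
  continuous (mulmxr A : 'M[R]_(m, n) -> 'M[R]_(m, p)).
Proof.
apply/(linear_bounded_continuous (mulmxr A)).
apply/linear_boundedP; near=> r => B /=.
rewrite (le_trans (mx_norm_mul _ _)) // -mulrA [X in _ * X]mulrC mulrA.
by apply: ler_wpM2r => //; near: r; exact: nbhs_pinfty_ge.
Unshelve. all: by end_near. Qed.

End mx_norm_theory.

(** * The exponential series *)

Section expm_theory.
Variable R : realType.

(** Absolute convergence: up to the constant factor [|1|], the scalar exponential series at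
    [n * |A|] dominates termwise. *)
Lemma expm_cvg n (A : 'M[R]_n) :
  series (fun k : nat => (k`!%:R)^-1 *: A ^+ k) @ \oo --> expm A.
Proof.
suff : cvgn (series (fun k : nat => (k`!%:R)^-1 *: A ^+ k)) by [].
apply: normed_cvg.
have normX k : `|A ^+ k| <= `|1%:M : 'M[R]_n| * (n%:R * `|A|) ^+ k.
  elim: k => [|k IH]; first by rewrite !expr0 mulr1.
  rewrite exprS exprS (le_trans (mx_norm_mul _ _)) // mulrCA.
  by rewrite ler_wpM2l // mulr_ge0.
apply: (@series_le_cvg _ _
  (fun k => `|1%:M : 'M[R]_n| * exp_coeff (n%:R * `|A|) k)) => [k|k|k|].
- exact: normr_ge0.
- by rewrite mulr_ge0 // exp_coeff_ge0 // mulr_ge0.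
- rewrite /= normrZ normfV normr_nat /exp_coeff /= mulrA mulrC.
  by rewrite ler_wpM2r.
- exact: (is_cvg_seriesZ (is_cvg_series_exp_coeff _)).
Qed.

Lemma mulmx_expm_cvg m n (A : 'M[R]_n) (P : 'M[R]_(m, n)) :
  series (fun k : nat => (k`!%:R)^-1 *: (P *m A ^+ k)) @ \oo --> P *m expm A.
Proof.
rewrite (_ : series _ =
    mulmx P \o series (fun k : nat => (k`!%:R)^-1 *: A ^+ k)); last first.
  apply/funext => k; rewrite /= /series /= mulmx_sumr.
  by apply: eq_bigr => i _; rewrite scalemxAr.
apply: continuous_cvg; last exact: expm_cvg.
exact: continuous_mulmx.
Qed.

Lemma expm_mulmx_cvg m n (A : 'M[R]_n) (P : 'M[R]_(n, m)) :
  series (fun k : nat => (k`!%:R)^-1 *: (A ^+ k *m P)) @ \oo --> expm A *m P.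
Proof.
rewrite (_ : series _ =
    mulmxr P \o series (fun k : nat => (k`!%:R)^-1 *: A ^+ k)); last first.
  apply/funext => k; rewrite /= /series /= mulmx_suml.
  by apply: eq_bigr => i _; rewrite scalemxAl.
apply: continuous_cvg; last exact: expm_cvg.
exact: continuous_mulmxr.
Qed.

(** The relation passes to all powers, then to the limit. It serves both for the commutation of [Z]
    with [expm Z] and for conjugation by [1 + t Z]. *)
Lemma expm_intertwine m n (A : 'M[R]_m) (B : 'M[R]_n) (P : 'M[R]_(m, n)) :
  P *m B = A *m P -> P *m expm B = expm A *m P.
Proof.
move=> PB.
have PBk k : P *m B ^+ k = A ^+ k *m P.
  elim: k => [|k IH]; first by rewrite !expr0 mulmx1 mul1mx.
  by rewrite !exprS -!mulmxE mulmxA PB -!mulmxA IH.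
apply: (cvg_unique (@norm_hausdorff _ _) (@mulmx_expm_cvg _ _ B P)).
rewrite [X in series X](_ : _ = fun k => (k`!%:R)^-1 *: (A ^+ k *m P)).
  exact: expm_mulmx_cvg.
by apply/funext => k; rewrite PBk.
Qed.

(** The hypotheses say that [a + i b] is a left eigenvector of [A] with eigenvalue [i x]; the
    conclusion is the real part of [exp (i x) (a + i b)]. *)
Lemma expm_rotation n (A : 'M[R]_n) (a b : 'rV[R]_n) (x : R) :
  a *m A = - x *: b -> b *m A = x *: a ->
  a *m expm A = cos x *: a - sin x *: b.
Proof.
move=> aA bA.
have aAk k : (k`!%:R)^-1 *: (a *m A ^+ k) =
    cos_coeff x k *: a - sin_coeff x k *: b.
  (* Even powers fall on [a] and odd ones on [b], with the signs of the cosine and sine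
     coefficients. At [k = 0] the truncated [k.-1] sits in a term killed by [odd k]. *)
  have E : a *m A ^+ k = ((~~ odd k)%:R * (-1) ^+ k./2 * x ^+ k) *: a
       - ((odd k)%:R * (-1) ^+ k.-1./2 * x ^+ k) *: b.
    elim: k => [|k IH].
      by rewrite !expr0 /= mulr0n mulmx1 !mulr1 scale1r ?mul0r scale0r subr0.
    rewrite exprSr -mulmxE mulmxA IH mulmxBl -!scalemxAl aA bA !scalerA /=.
    rewrite uphalf_half; move: (odd_double_half k).
    case: (odd k) => /= <-; rewrite !(mulr0n, mulr1n) ?add1n ?add0n /= ?uphalf_double ?doubleK.
      rewrite !mul0r !scale0r sub0r subr0 -scaleNr.
      by congr (_ *: _); rewrite !exprS; ring.
    rewrite !mul0r !scale0r sub0r subr0 -scaleNr.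
    by congr (_ *: _); rewrite !exprS; ring.
  rewrite E scalerBr !scalerA.
  by congr (_ *: _ - _ *: _); rewrite mulrC.
apply: (cvg_unique (@norm_hausdorff _ _) (@mulmx_expm_cvg _ _ A a)).
rewrite (_ : series _ = (fun k => series (cos_coeff x) k *: a
    - series (sin_coeff x) k *: b)); last first.
  apply/funext => k; rewrite /series /= !scaler_suml -sumrB.
  by apply: eq_bigr => i _.
apply: cvgB; apply: cvgZr_tmp.
  by rewrite unlock; exact: is_cvg_series_cos_coeff.
by rewrite unlock; exact: is_cvg_series_sin_coeff.
Qed.

End expm_theory.

(** * Preimages of Q commute with a D-preimage *)

(** Chain rule along the curve [x + t *: k t]. Its difference quotient at 0 is [k] itself, so the
    limit of [k] is the velocity. *)
Lemma diff_tangent (R : realType) (V W : normedModType R) (f : V -> W)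
    (k : R -> V) (x v : V) :
  differentiable f x -> k t @[t --> 0] --> v ->
  (\forall t \near 0, f (x + t *: k t) = f x) -> 'd f x v = 0.
Proof.
move=> fx kv fk; pose c t := x + t *: k t.
have c0 : c 0 = x by rewrite /c scale0r addr0.
have cv : h^-1 *: ((c \o shift 0) (h *: 1) - c 0) @[h --> 0^'] --> v.
  have kv' : k t @[t --> 0^'] --> v.
    by apply: cvg_trans kv; apply: cvg_app; exact: cvg_within.
  apply: cvg_trans kv'; apply: near_eq_cvg; near=> h.
  rewrite /= c0 /c addr0 addrAC subrr add0r scaler1 scalerA mulVf ?scale1r //.
  by near: h; exact: nbhs_dnbhs_neq.
have dc : differentiable c 0 by apply/derivable1_diffP/cvg_ex; exists v.
have dcv : 'd c 0 1 = v.
  by rewrite -deriveE //; exact: (cvg_lim (@norm_hausdorff _ _)).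
have fc0 : differentiable f (c 0) by rewrite c0.
have <- : 'd (f \o c) 0 1 = 'd f x v by rewrite diff_comp //= dcv c0.
rewrite -deriveE; last exact: differentiable_comp.
rewrite (near_eq_derive (g := cst (f x))) //.
exact: derive_cst.
Unshelve. all: by end_near. Qed.

Section resolvent.
Variables (R : realType) (n : nat) (Z : 'M[R]_n) (t : R).
Hypothesis tZ : `|t| * (n%:R * `|Z|) <= 2^-1.

(** By [tZ], the term [t Z v] has at most half the norm of [v]. This yields both the invertibility
    of [1 + t Z] and a bound on its inverse that is uniform in [t]. *)
Lemma resolvent_bound p (v : 'M[R]_(n, p)) : `|v| <= 2 * `|(1%:M + t *: Z) *m v|.
Proof.
have : `|v| <= `|(1%:M + t *: Z) *m v| + `|t *: (Z *m v)|.
  by rewrite mulmxDl mul1mx -scalemxAl (le_trans _ (ler_normB _ _)) // addrK.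
have : `|t *: (Z *m v)| <= 2^-1 * `|v|.
  rewrite normrZ (le_trans (ler_wpM2l _ (mx_norm_mul _ _))) //.
  by rewrite mulrA ler_wpM2r.
by lra.
Qed.

Lemma resolvent_unit : 1%:M + t *: Z \in unitmx.
Proof.
rewrite -unitmx_tr -row_free_unit; apply: inj_row_free => v.
move=> /(congr1 trmx); rewrite trmx_mul trmxK trmx0 => vT0.
have := resolvent_bound v^T; rewrite vT0 normr0 mulr0 normr_le0 => /eqP vT.
by rewrite -[v]trmxK vT trmx0.
Qed.

(** This identifies the conjugate of [X] by [1 + t Z] with a curve of the form [X + t *: k t], as
    [diff_tangent] requires. *)
Lemma resolvent_conj (X : 'M[R]_n) : 1%:M + t *: Z \in unitmx ->
  (1%:M + t *: Z) *m
    (X + t *: (invmx (1%:M + t *: Z) *m (X *m Z - Z *m X))) =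
  X *m (1%:M + t *: Z).
Proof.
move=> U; rewrite [LHS]mulmxDr -[X in _ + X]scalemxAr mulKVmx //.
rewrite mulmxDl mul1mx mulmxDr mulmx1.
by rewrite -scalemxAl -scalemxAr -addrA -scalerDr [Z *m X + _]addrC subrK.
Qed.

End resolvent.

(* If [f] is not differentiable at [x], then ['d f x] is the default value of
   the type of linear maps, which is the zero map. *)
Lemma diff_undef (R : realType) m n p q (f : 'M[R]_(m, n) -> 'M[R]_(p, q)) x v :
  ~ differentiable f x -> 'd f x v = 0.
Proof.
move=> ndf; rewrite /diff getPN // => df dfx; apply: ndf.
apply/diffP; rewrite /diff.
by apply: (@getI _ (fun df : {linear _ -> _} => continuous df /\ forall y,
  f y = f (lim (nbhs x)) + df (y - lim (nbhs x))
    +o_(y \near nbhs x) (y - lim (nbhs x))) df).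
Qed.

Lemma near0_mulr_le (R : realType) (c e : R) : 0 <= c -> 0 < e ->
  \forall t \near (0 : R), `|t| * c <= e.
Proof.
(* Since [c] may vanish, the division is by [c + 1]. *)
move=> c0 e0; have c1 : 0 < c + 1 by rewrite ltr_wpDl.
have := @nbhs0_le R R^o _ (divr_gt0 e0 c1); apply: filterS => t.
by rewrite ler_pdivlMr // => /(le_trans _); apply; rewrite mulrDr lerDl mulr1.
Qed.

Lemma dexp_commutator (R : realType) n (X Z : 'M[R]_n) :
  Z *m expm X = expm X *m Z -> 'd (@expm R n) X (X *m Z - Z *m X) = 0.
Proof.
set K := X *m Z - Z *m X => ZQ.
(* Where [expm] is not differentiable, ['d] is the default zero map and the claim holds as well. *)
have [dX|] := pselect (differentiable (@expm R n) X); last exact: diff_undef.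
have tZ : \forall t \near (0 : R), `|t| * (n%:R * `|Z|) <= 2^-1.
  by apply: near0_mulr_le; rewrite ?mulr_ge0 // invr_gt0.
pose k t := invmx (1%:M + t *: Z) *m K.
apply: (diff_tangent (k := k) dX).
  (* The tangent vector: [K - k t = t Z (k t)], where [k t] is bounded by [2 |K|], so the difference
     is of order [t]. *)
  apply/cvgrPdist_le => e e0; near=> t.
  have tZt : `|t| * (n%:R * `|Z|) <= 2^-1 by near: t.
  have kt : (1%:M + t *: Z) *m k t = K by exact: mulKVmx (resolvent_unit tZt) K.
  have -> : K - k t = t *: (Z *m k t).
    by rewrite -kt mulmxDl mul1mx addrAC subrr add0r scalemxAl.
  have kK : `|k t| <= 2 * `|K| by rewrite -kt resolvent_bound.
  rewrite normrZ.
  have h : `|Z *m k t| <= n%:R * `|Z| * (2 * `|K|).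
    by rewrite (le_trans (mx_norm_mul _ _)) // ler_wpM2l // mulr_ge0.
  rewrite (le_trans (ler_wpM2l _ h)) //.
  by near: t; apply: near0_mulr_le; rewrite ?mulr_ge0.
(* The constant value: the exponential of the conjugate is the conjugate of [expm X], which commutes
   with [1 + t Z]. *)
near=> t.
have U : 1%:M + t *: Z \in unitmx by apply: resolvent_unit; near: t.
have PY := resolvent_conj X U.
have /(congr1 (mulmx (invmx (1%:M + t *: Z)))) := expm_intertwine PY.
rewrite mulKmx // => ->.
have -> : expm X *m (1%:M + t *: Z) = (1%:M + t *: Z) *m expm X.
  by rewrite [LHS]mulmxDr [RHS]mulmxDl mulmx1 mul1mx -scalemxAr -scalemxAl ZQ.
by rewrite mulKmx.
Unshelve. all: by end_near. Qed.

Lemma D_preimage_comm (R : realType) n (Q X Z : 'M[R]_n) :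
  D_preimage Q X -> skew_log Q Z -> X *m Z = Z *m X.
Proof.
move=> [[skX expX] [_ ndef]] [skZ expZ]; apply/eqP; rewrite -subr_eq0; apply/eqP.
set K := _ - _.
have dK : 'd (@expm R n) X K = 0.
  by apply: dexp_commutator; rewrite expX -expZ; exact: expm_intertwine.
have skK : K \in skewv R n.
  apply/mem_skewv; rewrite /Skew /= linearB /= !trmx_mul skX skZ.
  by rewrite !mulmxN !mulNmx !opprK opprB.
apply/eqP; rewrite -memv0.
(* By rank-nullity, a nonzero kernel on the skew-symmetric matrices would make the differential
   rank-deficient at [X]. *)
suff <- : (skewv R n :&: lker (linfun ('d (@expm R n) X)))%VS = 0%VS.
  by rewrite memv_cap skK memv_ker lfunE /= dK.
apply/eqP; rewrite -dimv_eq0 -leqn0 leqNgt; apply/negP => ker_gt0; apply: ndef.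
split => //; rewrite -[X in (_ < X)%N](limg_ker_dim (linfun ('d (@expm R n) X))).
by rewrite -[X in (X < _)%N]add0n ltn_add2r.
Qed.

(** * Common unitary diagonalization, in real and imaginary parts *)

Section complex_matrix.
Variable R : rcfType.
Local Notation rc := (real_complex R).
Local Notation toC A := (map_mx rc A).

Lemma toC_inj m n (A B A' B' : 'M[R]_(m, n)) :
  toC A + 'i%C *: toC B = toC A' + 'i%C *: toC B' -> A = A' /\ B = B'.
Proof.
move=> /matrixP E; split; apply/matrixP => i j; move: (E i j).
  by rewrite !mxE => -[]; rewrite !(mul0r, mulr0, mul1r, subr0, addr0, add0r).
by rewrite !mxE => -[] _; rewrite !(mul0r, mulr0, mul1r, subr0, addr0, add0r).
Qed.

Lemma toC_surj m n (P : 'M[R[i]]_(m, n)) :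
  exists A B : 'M[R]_(m, n), P = toC A + 'i%C *: toC B.
Proof.
exists (map_mx (@complex.Re R) P), (map_mx (@complex.Im R) P).
by apply/matrixP => i j; rewrite !mxE [LHS]complexE.
Qed.

Lemma toC_trmxC m n (A B : 'M[R]_(m, n)) :
  map_mx Num.conj (toC A + 'i%C *: toC B)^T = toC A^T - 'i%C *: toC B^T.
Proof.
apply/matrixP => i j; rewrite !mxE.
apply/eqP; rewrite eq_complex /=.
by apply/andP; split; apply/eqP; ring.
Qed.

Lemma toC_mul m n p (A B : 'M[R]_(m, n)) (A' B' : 'M[R]_(n, p)) :
  (toC A + 'i%C *: toC B) *m (toC A' + 'i%C *: toC B') =
  toC (A *m A' - B *m B') + 'i%C *: toC (A *m B' + B *m A').
Proof.
rewrite mulmxDl !mulmxDr -!scalemxAl -!scalemxAr scalerA -expr2 sqr_i scaleN1r.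
rewrite map_mxB map_mxD !map_mxM scalerDr.
by rewrite [X in _ + X = _]addrC addrACA.
Qed.

(** The conjugate of [X] by [P] is both triangular and skew-Hermitian, hence diagonal with imaginary
    entries. *)
Lemma skew_unitary_diag n (P : 'M[R[i]]_n) (X : 'M[R]_n) :
  P \is unitarymx -> similar_trig P (toC X) -> X^T = - X ->
  exists x : 'rV[R]_n, P *m toC X = 'i%C *: (toC (diag_mx x) *m P).
Proof.
move=> Pu; rewrite /similar_to /= conjymx //.
set T := P *m _ *m _ => /is_trig_mxP Ttrig skX.
have TN : map_mx Num.conj T^T = - T.
  rewrite /T !trmx_mul !map_mxM /= trmxCK.
  have -> : map_mx Num.conj (toC X)^T = - toC X.
    have := toC_trmxC X 0; rewrite map_mx0 scaler0 trmx0 map_mx0 addr0 scaler0.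
    by rewrite subr0 skX map_mxN.
  by rewrite mulNmx mulmxN mulmxA.
have TNE (i j : 'I_n) : Num.conj (T j i) = - T i j.
  by have := congr1 (fun M : 'M[R[i]]_n => M i j) TN; rewrite 2!mxE [RHS]mxE.
exists (\row_j complex.Im (T j j)).
have -> : P *m toC X = T *m P.
  by rewrite /T mulmxKtV.
rewrite scalemxAl; congr (_ *m _); clearbody T.
apply/matrixP => i j; rewrite !mxE.
case: (ltngtP i j) => [ij|ji|/val_inj ->].
- by rewrite Ttrig // -val_eqE (ltn_eqF ij) mulr0n mulr0.
- have /eqP := TNE i j; rewrite Ttrig // conjC0 eq_sym oppr_eq0 => /eqP ->.
  by rewrite -val_eqE (gtn_eqF ji) mulr0n mulr0.
- have := TNE j j; rewrite eqxx mulr1n.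
  rewrite -[Num.conj _]/(conjc (T j j)); case: (T j j) => a b /=.
  move=> /eqP; rewrite eq_complex /= => /andP[/eqP aN _].
  have a0 : a = 0 by lra.
  rewrite a0; apply/eqP; rewrite eq_complex /= !mul0r !mul1r.
  by apply/andP; split; apply/eqP; ring.
Qed.

(* The rows of [A + i B] are the common eigenvectors, with eigenvalues [i x_j] and
   [i z_j]. *)
Lemma skew_codiag n (X Z : 'M[R]_n) :
  X^T = - X -> Z^T = - Z -> X *m Z = Z *m X ->
  exists A B : 'M[R]_n, exists x z : 'rV[R]_n,
  [/\ A *m A^T + B *m B^T = 1%:M, A^T *m A + B^T *m B = 1%:M,
      A *m X = - (diag_mx x *m B) /\ B *m X = diag_mx x *m A &
      A *m Z = - (diag_mx z *m B) /\ B *m Z = diag_mx z *m A].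
Proof.
move=> skX skZ XZ.
(* Commuting complex matrices have a common unitary triangularization. *)
have [|P Pu /andP[trX trZ]] := @cotrigonalization2 _ n (toC X) (toC Z).
  by rewrite -!map_mxM XZ.
have [x PX] := skew_unitary_diag Pu trX skX.
have [z PZ] := skew_unitary_diag Pu trZ skZ.
have PPt := unitarymxP Pu; have PtP := mulmx1C PPt.
have [A [B PE]] := toC_surj P.
have toC_unit m (C D E F : 'M[R]_m) :
    (toC C + 'i%C *: toC D) *m (toC E + 'i%C *: toC F) = 1%:M ->
    C *m E - D *m F = 1%:M /\ C *m F + D *m E = 0.
  rewrite toC_mul => CDEF; apply: toC_inj; rewrite CDEF.
  by rewrite map_mx1 map_mx0 scaler0 addr0.
have eigen (Y : 'M[R]_n) (y : 'rV[R]_n) :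
    P *m toC Y = 'i%C *: (toC (diag_mx y) *m P) ->
    A *m Y = - (diag_mx y *m B) /\ B *m Y = diag_mx y *m A.
  rewrite PE mulmxDr mulmxDl scalerDr -!scalemxAl -scalemxAr scalerA -expr2.
  rewrite sqr_i scaleN1r -!map_mxM -map_mxN [RHS]addrC.
  by move=> /toC_inj.
exists A, B, x, z; split; [| |exact: eigen|exact: eigen].
  move: PPt; rewrite PE toC_trmxC -scalerN -map_mxN => /toC_unit[<- _].
  by rewrite mulmxN opprK.
move: PtP; rewrite PE toC_trmxC -scalerN -map_mxN => /toC_unit[<- _].
by rewrite mulNmx opprK.
Qed.

End complex_matrix.

(** * Angles and plane rotations *)

(** By the addition formula [|y - x|] has cosine 1. Below [2 pi] this forces 0: cosine is injective
    on [[0, pi]], and reflection at [pi] covers the rest. *)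
Lemma cos_sin_eq (R : realType) (x y : R) : cos x = cos y -> sin x = sin y ->
  x = y \/ pi *+ 2 <= `|y - x|.
Proof.
move=> cxy sxy; have [|yx_lt] := leP (pi *+ 2) `|y - x|; first by right.
left; apply/eqP; rewrite eq_sym -subr_eq0; apply/eqP.
have c1 : cos `|y - x| = 1 by rewrite cos_norm cosB cxy sxy -!expr2 cos2Dsin2.
have [yx_le|yx_gt] := leP `|y - x| pi.
  apply/eqP; rewrite -normr_eq0; apply/eqP; apply: cos_inj.
  - by rewrite in_itv /= normr_ge0.
  - by rewrite in_itv /= lexx pi_ge0.
  - by rewrite c1 cos0.
exfalso; suff : pi *+ 2 - `|y - x| = 0 by lra.
apply: cos_inj.
- by rewrite in_itv /=; apply/andP; split; lra.
- by rewrite in_itv /= lexx pi_ge0.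
- by rewrite cos0 -c1 cosB cos2pi sin2pi mul1r mul0r addr0.
Qed.

(** The equations say that [((c - c') + i (s - s')) (a + i b) = 0]. Multiplying by the conjugate of
    the first factor makes its squared modulus [d] annihilate [a] and [b]. *)
Lemma rotation_eq (F : realFieldType) (a b c s c' s' : F) :
  c * a - s * b = c' * a - s' * b -> c * b + s * a = c' * b + s' * a ->
  (a != 0) || (b != 0) -> c = c' /\ s = s'.
Proof.
move=> e1 e2 ab0; set d := (c - c') ^+ 2 + (s - s') ^+ 2.
have da : d * a = 0.
  transitivity ((c - c') * ((c * a - s * b) - (c' * a - s' * b)) +
      (s - s') * ((c * b + s * a) - (c' * b + s' * a))).
    by rewrite /d; ring.
  by rewrite e1 e2 !subrr !mulr0 addr0.
have db : d * b = 0.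
  transitivity ((c - c') * ((c * b + s * a) - (c' * b + s' * a)) -
      (s - s') * ((c * a - s * b) - (c' * a - s' * b))).
    by rewrite /d; ring.
  by rewrite e1 e2 !subrr !mulr0 subr0.
have /eqP : d = 0.
  case/orP: ab0 => n0; by apply: (mulIf n0); rewrite mul0r.
rewrite paddr_eq0 ?sqr_ge0 // !sqrf_eq0 !subr_eq0.
by move=> /andP[/eqP -> /eqP ->].
Qed.

(** * Frobenius distance in the common eigenbasis *)

Section codiagonal.
Variables (R : realType) (n : nat) (A B D : 'M[R]_n) (d : 'rV[R]_n).
Hypotheses (AAt : A *m A^T + B *m B^T = 1%:M).
Hypotheses (AtA : A^T *m A + B^T *m B = 1%:M).
Hypotheses (AD : A *m D = - (diag_mx d *m B)) (BD : B *m D = diag_mx d *m A).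

(** Invariance of the trace under the unitary [A + i B]; the right-hand side is the real part of the
    trace of the conjugate. *)
Lemma trace_codiag (M : 'M[R]_n) :
  \tr M = \tr (A *m M *m A^T) + \tr (B *m M *m B^T).
Proof.
by rewrite !(mxtrace_mulC (_ *m M)) !mulmxA -mxtraceD -mulmxDl AtA mul1mx.
Qed.

Lemma trace_diag_mul (M : 'M[R]_n) :
  \tr (diag_mx d *m M) = \sum_j d 0 j * M j j.
Proof. by apply: eq_bigr => j _; rewrite mul_diag_mx mxE. Qed.

(** The square expands to [|W|^2 + 2 tr (D W^T) + tr (D D^T)], and both traces are evaluated in the
    eigenbasis. *)
Lemma frobenius_norm_codiag (W : 'M[R]_n) :
  frobenius_norm (W + D) ^+ 2 = frobenius_norm W ^+ 2 +
    \sum_j (d 0 j ^+ 2 +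
      2 * (d 0 j * ((B *m W *m A^T) j j - (A *m W *m B^T) j j))).
Proof.
have DD : \tr (D *m D^T) = \sum_j d 0 j ^+ 2.
  rewrite trace_codiag !mulmxA -!(mulmxA (_ *m D)) -!trmx_mul AD BD.
  rewrite linearN /= mulmxN mulNmx opprK !trmx_mul tr_diag_mx -!mulmxA.
  rewrite !trace_diag_mul -big_split /=; apply: eq_bigr => j _.
  rewrite !mulmxA !mul_mx_diag !mxE -mulrDr -mulrDl.
  have /matrixP/(_ j j) := AAt; rewrite !mxE addrC eqxx => ->.
  by rewrite mul1r expr2.
have WT (U V : 'M[R]_n) j :
    (U *m (W^T *m V^T)) j j = (V *m (W *m U^T)) j j.
  rewrite [RHS](_ : _ = (V *m (W *m U^T))^T j j); last by rewrite [RHS]mxE.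
  by rewrite !trmx_mul trmxK mulmxA.
have DW : \tr (D *m W^T) =
    \sum_j d 0 j * ((B *m W *m A^T) j j - (A *m W *m B^T) j j).
  rewrite trace_codiag !mulmxA AD BD !mulNmx -!mulmxA linearN /=.
  rewrite !trace_diag_mul addrC -sumrB; apply: eq_bigr => j _.
  by rewrite !WT mulrBr.
have WD : \tr (W *m D^T) = \tr (D *m W^T).
  by rewrite -mxtrace_tr trmx_mul trmxK.
rewrite !frobenius_norm_sqr linearD /= mulmxDl !mulmxDr !mxtraceD WD DD DW.
rewrite big_split -mulr_sumr /=; ring.
Qed.

(** Each of the two terms is at most [|W|_2 |a_j| |b_j|], and
    [2 |a_j| |b_j| <= |a_j|^2 + |b_j|^2 = 1]. *)
Lemma codiag_cross_bound (W : 'M[R]_n) j :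
  `|(B *m W *m A^T) j j - (A *m W *m B^T) j j| <= spectral_norm W.
Proof.
have bound (U V : 'M[R]_n) : `|(U *m W *m V^T) j j| <=
    spectral_norm W * (frobenius_norm (row j U) * frobenius_norm (row j V)).
  have -> : (U *m W *m V^T) j j = (row j U *m (W *m (row j V)^T)) 0 0.
    rewrite tr_row mulmxA -!row_mul.
    rewrite [RHS]mxE [RHS]mxE [LHS]mxE; apply: eq_bigr => k _.
    by congr (_ * _); rewrite !mxE.
  rewrite -frobenius_norm11 (le_trans (frobenius_norm_mul _ _)) //.
  rewrite mulrCA ler_wpM2l ?frobenius_norm_ge0 //.
  by rewrite -[X in _ * X]frobenius_norm_tr le_spectral_norm.
have ab : frobenius_norm (row j A) ^+ 2 + frobenius_norm (row j B) ^+ 2 = 1.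
  have /matrixP/(_ j j) := AAt; rewrite !mxE eqxx mulr1n => <-.
  rewrite !frobenius_norm_sqr !trace_mx11 !mxE.
  by congr (_ + _); apply: eq_bigr => k _; rewrite !mxE.
rewrite (le_trans (ler_normB _ _)) // (le_trans (lerD (bound _ _) (bound _ _))) //.
rewrite -mulrDr ler_piMr ?spectral_norm_ge0 //.
have := sqr_ge0 (frobenius_norm (row j A) - frobenius_norm (row j B)).
by rewrite sqrrB; lra.
Qed.

End codiagonal.

Lemma eigen_row (R : comPzRingType) n (A B X : 'M[R]_n) (x : 'rV[R]_n) j :
  A *m X = - (diag_mx x *m B) -> row j A *m X = - x 0 j *: row j B.
Proof.
move=> AX; rewrite -row_mul AX mul_diag_mx; apply/rowP => k.
by rewrite !mxE mulNr.
Qed.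

(** Both exponentials rotate the pair of rows [a_j], [b_j], by the angles [x_j] and [z_j]; comparing
    them at one nonzero entry suffices. *)
Lemma expm_eq_eigen (R : realType) n (X Z A B : 'M[R]_n) (x z : 'rV[R]_n) j :
  A *m A^T + B *m B^T = 1%:M ->
  A *m X = - (diag_mx x *m B) -> B *m X = diag_mx x *m A ->
  A *m Z = - (diag_mx z *m B) -> B *m Z = diag_mx z *m A ->
  expm X = expm Z ->
  cos (x 0 j) = cos (z 0 j) /\ sin (x 0 j) = sin (z 0 j).
Proof.
move=> AAt AX BX AZ BZ XZ.
have rowE (Y : 'M[R]_n) (y : 'rV[R]_n) :
    A *m Y = - (diag_mx y *m B) -> B *m Y = diag_mx y *m A ->
    row j A *m expm Y = cos (y 0 j) *: row j A - sin (y 0 j) *: row j B /\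
    row j B *m expm Y = cos (y 0 j) *: row j B + sin (y 0 j) *: row j A.
  move=> AY BY; have aY := eigen_row j AY.
  have bY : row j B *m Y = y 0 j *: row j A.
    by rewrite -row_mul BY mul_diag_mx; apply/rowP => k; rewrite !mxE.
  split; first exact: expm_rotation.
  (* The pair [(b_j, - a_j)] satisfies the same relations as [(a_j, b_j)]. *)
  rewrite (@expm_rotation _ _ _ _ (- row j A) (y 0 j)) ?scalerN ?opprK //.
    by rewrite scaleNr opprK.
  by rewrite mulNmx aY scaleNr opprK.
have [aX bX] := rowE _ _ AX BX; have [aZ bZ] := rowE _ _ AZ BZ.
have [k ab0] : exists k, (A j k != 0) || (B j k != 0).
  apply/existsP; apply: contraT => /existsPn ab.
  have /matrixP/(_ j j) := AAt; rewrite !mxE eqxx !big1 => [|k _|k _].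
  - by move=> /esym/eqP; rewrite addr0 oner_eq0.
  - by have := ab k; rewrite negb_or !negbK => /andP[_ /eqP ->]; rewrite mul0r.
  - by have := ab k; rewrite negb_or !negbK => /andP[/eqP -> _]; rewrite mul0r.
apply: (rotation_eq (a := A j k) (b := B j k)) => //.
  by move: aX; rewrite XZ aZ => /rowP/(_ k); rewrite !mxE.
by move: bX; rewrite XZ bZ => /rowP/(_ k); rewrite !mxE.
Qed.

Theorem proposition5p7 (R : realType) (n : nat) (Q S X : 'M[R]_n)
    (hQ : @SO R n Q) (hS : @Skew R n S) (hX : D_preimage Q X)
    (hXS : spectral_norm (X - S) < pi) :
  argmin (skew_log Q) (fun Z : 'M[R]_n => frobenius_norm (Z - S)) = [set X].
Proof.
have [XQ _] := hX.
(* The inequality gives minimality of [X], its equality case uniqueness. *)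
suff closest Z : skew_log Q Z -> frobenius_norm (X - S) <= frobenius_norm (Z - S)
    /\ (frobenius_norm (Z - S) = frobenius_norm (X - S) -> Z = X).
  apply/seteqP; split=> [Z /= [ZQ Zmin]|Z /= ->]; last first.
    by split=> // Z' /closest[].
  have [XZ ZX] := closest Z ZQ; apply: ZX; apply: le_anti.
  by rewrite XZ Zmin.
move=> ZQ; have XZ := D_preimage_comm hX ZQ.
have [[skX expX] [skZ expZ]] := (XQ, ZQ).
have [A [B [x [z [AAt AtA [AX BX] [AZ BZ]]]]]] := skew_codiag skX skZ XZ.
pose d := z - x; set W := X - S.
have AD : A *m (Z - X) = - (diag_mx d *m B).
  by rewrite mulmxBr AX AZ /d linearB /= mulmxBl opprK opprB addrC.
have BD : B *m (Z - X) = diag_mx d *m A.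
  by rewrite mulmxBr BX BZ /d linearB /= mulmxBl.
have := frobenius_norm_codiag AAt AtA AD BD W.
rewrite /W addrC addrA subrK -/W.
set g := BIG_F => normE.
(* If [d_j] is nonzero, then [|d_j| >= 2 pi > 2 |w|], so [d_j^2 + 2 d_j w >= |d_j| (|d_j| - 2 |w|) >
   0]. *)
have gE j : d 0 j = 0 \/ 0 < g j.
  have [cxz sxz] := expm_eq_eigen j AAt AX BX AZ BZ (etrans expX (esym expZ)).
  have [xz|dpi] := cos_sin_eq cxz sxz; [left|right].
    by rewrite /d !mxE xz subrr.
  have dE : d 0 j = z 0 j - x 0 j by rewrite !mxE.
  have := codiag_cross_bound AAt W j; rewrite /g.
  move: (_ - _ : R) => w wW; rewrite -dE in dpi.
  have wpi : `|w| < pi := le_lt_trans wW hXS.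
  have := ler_norm (- (d 0 j * w)); rewrite normrN normrM => h.
  have d0 : 0 < `|d 0 j| by rewrite (lt_le_trans _ dpi) // mulrn_wgt0 // pi_gt0.
  rewrite -[d 0 j ^+ 2]real_normK ?num_real //.
  have := pi_gt0 R; nra.
have g0 j : 0 <= g j.
  by have [dj0|/ltW //] := gE j; rewrite /g dj0 expr0n /= !mul0r mulr0 addr0.
have sg0 : 0 <= \sum_j g j by apply: sumr_ge0.
split=> [|eqn].
  rewrite -(@ler_pXn2r _ 2) ?nnegrE ?frobenius_norm_ge0 //.
  by rewrite normE lerDl.
have /eqP : \sum_j g j = 0 by move: normE; rewrite eqn; lra.
rewrite psumr_eq0 // => /allP gj0.
have d0 : d = 0.
  apply/rowP => j; rewrite [RHS]mxE; have [//|] := gE j.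
  by have /eqP -> := gj0 j (mem_index_enum _); rewrite ltxx.
apply/eqP; rewrite -subr_eq0; apply/eqP.
(* Inserting [A^T A + B^T B = 1] expresses [Z - X] through [diag_mx d], which is zero. *)
rewrite -[Z - X]mul1mx -AtA mulmxDl -!mulmxA AD BD d0 linear0.
by rewrite !mul0mx oppr0 !mulmx0 addr0.
Qed.
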